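(* Let $\mathcal{B}$ be a basic graph equipped with an adapted complex structure $J$, let $\widetilde{\mathcal{B}}$ be an expansion of $\mathcal{B}$, and let $\widetilde{J}$ be the almost complex structure on $\mathfrak{n}_{\widetilde{\mathcal{B}}}$ extending $J$ described in the context. Then $\widetilde{J}$ is integrable; hence, it defines an adapted complex structure on the expansion $\widetilde{\mathcal{B}}$ of $\mathcal{B}$ which extends the adapted complex structure $J$ on $\mathcal{B}$.
   Context: Graphs are finite and simple: $\mathcal{G}=(V,E)$ with $V$ a finite set and $E$ a set of 2-element subsets of $V$; $\overline{uv}$ denotes the edge $\{u,v\}$. Label $V=\{v_1,\dots,v_n\}$ and write $e_{i,j}=e_{j,i}$ for the edge joining $v_i$ and $v_j$, if it exists. The Lie algebra $\mathfrak{n}_{\mathcal{G}}$ is the real vector space with basis $V\cup E$ and Lie bracket $[v_i,v_j]=e_{i,j}$ for $i<j$ if $v_i,v_j$ are adjacent, $[v_i,v_j]=0$ if they are not adjacent, and all elements of $E$ central. An almost complex structure on a real Lie algebra $\mathfrak{g}$ is a linear map $J:\mathfrak{g}\to\mathfrak{g}$ with $J^2=-\mathrm{Id}$; it is integrable (a complex structure) if $[x,y]+J([Jx,y]+[x,Jy])-[Jx,Jy]=0$ for all $x,y\in\mathfrak{g}$. An adapted complex structure on the graph $\mathcal{G}$ is a complex structure $J$ on $\mathfrak{n}_{\mathcal{G}}$ such that for every $x\in V\cup E$ either $Jx\in V\cup E$ or $-Jx\in V\cup E$. A graph is basic if it is a disjoint union of copies of the following graphs: $\mathbb{A}_1$ (two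 vertices, no edges), $\mathbb{A}_2$ (three vertices and exactly one edge), $\mathbb{A}_3$ (four vertices and exactly two edges, which share no vertex). Expansion: let $\mathcal{B}$ be a basic graph with an adapted complex structure $J$. Choose a vertex $u$ and a pair of vertices $v,w$ with $w=Jv$, $u\neq v$, $u\neq w$, and add the two edges $\overline{uv}$ and $\overline{uw}$. Repeat this finitely many times (possibly zero), where the same vertices may be used again as long as the two edges added at each step are different from all edges added before. Any graph $\widetilde{\mathcal{B}}$ obtained in this way is called an expansion of $\mathcal{B}$ (it has the same vertices as $\mathcal{B}$). The map $\widetilde{J}$: label the vertices of $\mathcal{B}$ (equivalently of $\widetilde{\mathcal{B}}$) arbitrarily as $v_1,\dots,v_n$, and use this labelling for the Lie brackets. Set $\widetilde{J}=J$ on the vertices and edges of $\mathcal{B}$. For each pair of new edges $e_{i,k}=\overline{v_iv_k}$, $e_{j,k}=\overline{v_jv_k}$ added in one step (with $u=v_k$, and $Jv_i=v_j$), set $$\widetilde{J}e_{i,k}=\begin{cases} e_{j,k}, & \text{if } k<i,j \text{ or } k>i,j,\\ -e_{j,k}, & \text{if } i<k<j \text{ or } j<k<i,\end{cases}$$ and extend so that $\widetilde{J}^2=-\mathrm{Id}$. *)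

(* Defs.v *)
From HB Require Import structures.
From mathcomp Require Import all_boot all_order all_algebra.
From mathcomp Require Import reals.

Set Implicit Arguments.
Unset Strict Implicit.
Unset Printing Implicit Defensive.

Import Order.TTheory GRing.Theory Num.Theory.
Local Open Scope ring_scope.

Record lieAlgebra (R : realType) := LieAlgebra {
  lie_space :> vectType R;
  lie : lie_space -> lie_space -> lie_space;
  lie_linearl : forall y a x x', lie (a *: x + x') y = a *: lie x y + lie x' y;
  lie_linearr : forall x a y y', lie x (a *: y + y') = a *: lie x y + lie x y';
  lie_alternating : forall x, lie x x = 0;
  lie_jacobi : forall x y z,
    lie x (lie y z) + lie y (lie z x) + lie z (lie x y) = 0
}.

Notation "[lie x , y ]" := (lie x y) (at level 0, x at level 99, format "[lie  x ,  y ]").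

Definition almost_complex (R : realType) (g : lieAlgebra R) (J : 'End(g)) :=
  forall x : g, J (J x) = - x.

Definition integrable (R : realType) (g : lieAlgebra R) (J : 'End(g)) :=
  forall x y : g,
    [lie x, y] + J ([lie J x, y] + [lie x, J y]) - [lie J x, J y] = 0.

Definition complex_structure (R : realType) (g : lieAlgebra R) (J : 'End(g)) :=
  almost_complex J /\ integrable J.

Record graph (V : finType) := Graph {
  edges : {set {set V}};
  edges_card2 : forall e, e \in edges -> #|e| = 2
}.

Definition graph_iso (V W : finType) (G : graph V) (H : graph W) :=
  exists2 f : V -> W, bijective f &
    forall e : {set V}, (f @: e \in edges H) = (e \in edges G).

Lemma disjoint_union_card2 (I : finType) (T : I -> finType)
    (F : forall i, graph (T i)) (e : {set {i : I & T i}}) :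
  e \in \bigcup_(i : I) [set [set Tagged T x | x in d] | d : {set T i} in edges (F i)] ->
  #|e| = 2.
Proof.
case/bigcupP=> i _ /imsetP[d /edges_card2 d2 ->]; rewrite card_imset //.
by move=> x y /eqP; rewrite eq_Tagged => /eqP.
Qed.

Definition disjoint_union (I : finType) (T : I -> finType)
    (F : forall i, graph (T i)) : graph {i : I & T i} :=
  Graph (@disjoint_union_card2 I T F).

Lemma graph_A1_card2 (e : {set 'I_2}) : e \in set0 -> #|e| = 2.
Proof. by rewrite inE. Qed.

Lemma graph_A2_card2 (e : {set 'I_3}) :
  e \in [set [set inord 0; inord 1]] -> #|e| = 2.
Proof. by move=> /set1P->; rewrite cards2 -val_eqE /= !inordK. Qed.

Lemma graph_A3_card2 (e : {set 'I_4}) :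
  e \in [set [set inord 0; inord 1]; [set inord 2; inord 3]] -> #|e| = 2.
Proof. by move=> /set2P[]->; rewrite cards2 -val_eqE /= !inordK. Qed.

Inductive basic_piece := A1 | A2 | A3.

Definition piece_vertices (p : basic_piece) : finType :=
  match p with A1 => 'I_2 | A2 => 'I_3 | A3 => 'I_4 end.

Definition piece_graph (p : basic_piece) : graph (piece_vertices p) :=
  match p with
  | A1 => Graph graph_A1_card2
  | A2 => Graph graph_A2_card2
  | A3 => Graph graph_A3_card2
  end.

Definition basic (V : finType) (G : graph V) :=
  exists (m : nat) (p : 'I_m -> basic_piece),
    graph_iso G (disjoint_union (fun i => piece_graph (p i))).

Definition edge (V : finType) (G : graph V) := {e : {set V} | e \in edges G}.

Section GraphLieAlgebra.
Variables (R : realType) (V : finType) (G : graph V).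
Variables (n : nat) (lab : V -> 'I_n).

(* Functions on V + E, i.e. the space with basis V + E; R^o is R seen as a
   module over itself. *)
Definition graph_space := {ffun V + edge G -> R^o}.

Definition basis_vec (i : V + edge G) : graph_space := [ffun j => (j == i)%:R].

(* The edge joining a and b, or 0 if they are not adjacent. *)
Definition edge_vec (a b : V) : graph_space :=
  if insub [set a; b] is Some e then basis_vec (inr e) else 0.

Definition basis_bracket (i j : V + edge G) : graph_space :=
  match i, j with
  | inl a, inl b =>
      if (lab a < lab b)%N then edge_vec a b
      else if (lab b < lab a)%N then - edge_vec a b
      else 0
  | _, _ => 0
  end.

Definition graph_bracket (x y : graph_space) : graph_space :=
  \sum_i \sum_j (x i * y j) *: basis_bracket i j.

Lemma graph_bracket_linearl y a x x' :
  graph_bracket (a *: x + x') y = a *: graph_bracket x y + graph_bracket x' y.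
Proof.
rewrite scaler_sumr -big_split; apply: eq_bigr => i _ /=.
rewrite scaler_sumr -big_split; apply: eq_bigr => j _ /=.
by rewrite !ffunE scalerA -scalerDl mulrDl mulrA.
Qed.

Lemma basis_bracketC i j : basis_bracket i j = - basis_bracket j i.
Proof.
case: i j => [a|e] [b|f] /=; rewrite ?oppr0 //.
rewrite /edge_vec [[set b; a]]setUC.
by case: ltngtP; rewrite ?opprK ?oppr0.
Qed.

Lemma graph_bracketC x y : graph_bracket x y = - graph_bracket y x.
Proof.
rewrite /graph_bracket exchange_big -sumrN; apply: eq_bigr => j _ /=.
rewrite -sumrN; apply: eq_bigr => i _.
by rewrite basis_bracketC scalerN mulrC.
Qed.

Lemma graph_bracket_linearr x a y y' :
  graph_bracket x (a *: y + y') = a *: graph_bracket x y + graph_bracket x y'.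
Proof.
by rewrite !(graph_bracketC x) graph_bracket_linearl opprD scalerN.
Qed.

Lemma graph_bracket_alternating x : graph_bracket x x = 0.
Proof.
have /eqP := graph_bracketC x x; rewrite -addr_eq0 -mulr2n -scaler_nat.
by rewrite scaler_eq0 pnatr_eq0 => /eqP.
Qed.

Lemma graph_bracket_vertex x y a : graph_bracket x y (inl a) = 0.
Proof.
rewrite sum_ffunE big1 // => i _; rewrite sum_ffunE big1 // => j _.
rewrite ffunE; suff -> : basis_bracket i j (inl a) = 0 by rewrite scaler0.
have ev b c : edge_vec b c (inl a) = 0.
  by rewrite /edge_vec; case: insub => [e|]; rewrite ffunE.
case: i j => [b|e] [c|f] /=; rewrite ?ffunE //.
by case: ltngtP => _; rewrite ?ffunE ?ev ?oppr0.
Qed.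

Lemma graph_bracket_bracket x y z : graph_bracket x (graph_bracket y z) = 0.
Proof.
rewrite {1}/graph_bracket big1 // => i _; rewrite big1 // => -[b|f] _.
  by rewrite graph_bracket_vertex mulr0 scale0r.
by case: i => [a|e]; rewrite scaler0.
Qed.

Lemma graph_bracket_jacobi x y z :
  graph_bracket x (graph_bracket y z) + graph_bracket y (graph_bracket z x) +
  graph_bracket z (graph_bracket x y) = 0.
Proof. by rewrite !graph_bracket_bracket !addr0. Qed.

Definition graph_lie : lieAlgebra R :=
  @LieAlgebra R graph_space graph_bracket graph_bracket_linearl
    graph_bracket_linearr graph_bracket_alternating graph_bracket_jacobi.

End GraphLieAlgebra.

Definition adapted_complex_structure (R : realType) (V : finType) (G : graph V)
    (n : nat) (lab : V -> 'I_n) (J : 'End(graph_lie R G lab)) :=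
  complex_structure J /\
  forall i : V + edge G, exists j : V + edge G,
    J (basis_vec R i) = basis_vec R j \/ - J (basis_vec R i) = basis_vec R j.

(* The step (u, v, w) adds the edges uv and uw. *)
Definition added_edges (V : finType) (s : seq (V * V * V)) : {set {set V}} :=
  [set e | has (fun '(u, v, w) => (e == [set u; v]) || (e == [set u; w])) s].

Section Expansion.
Variables (R : realType) (V : finType) (B : graph V).
Variables (n : nat) (lab : V -> 'I_n) (J : 'End(graph_lie R B lab)).

(* The lists of steps are in chronological order.  Only edges added by earlier
   steps are excluded; no new edge can be an edge of a basic graph. *)
Inductive expansion_steps : seq (V * V * V) -> Prop :=
| expansion_nil : expansion_steps [::]
| expansion_rcons s u v w :
    expansion_steps s ->
    basis_vec R (inl w) = J (basis_vec R (inl v)) ->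
    u != v -> u != w ->
    [set u; v] \notin added_edges s ->
    [set u; w] \notin added_edges s ->
    expansion_steps (rcons s (u, v, w)).

Definition expansion (s : seq (V * V * V)) (Bt : graph V) :=
  expansion_steps s /\ edges Bt = edges B :|: added_edges s.

End Expansion.

(* For edges G included in edges H, the inclusion of the span of V and
   (edges G) into the span of V and (edges H): coordinates on the edges of H
   that are not edges of G are 0. *)
Definition incl (R : realType) (V : finType) (G H : graph V)
    (x : graph_space R G) : graph_space R H :=
  [ffun i => match i with
             | inl a => x (inl a)
             | inr e => if insub (val e) is Some e' then x (inr e') else 0
             end].

Lemma incl_vertex (R : realType) (V : finType) (G H : graph V) (a : V) :
  incl H (basis_vec R (inl a : V + edge G)) = basis_vec R (inl a).
Proof.
apply/ffunP => -[b|e]; rewrite !ffunE //.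
by case: insub => [e'|]; rewrite ?ffunE.
Qed.

Lemma incl_edge (R : realType) (V : finType) (G H : graph V) (a b : V) :
  edges G \subset edges H -> [set a; b] \in edges G ->
  incl H (edge_vec R G a b) = edge_vec R H a b.
Proof.
move=> /subsetP sGH Gab; rewrite /edge_vec !insubT ?sGH // => Hab.
apply/ffunP => -[c|e]; rewrite !ffunE //.
case: insubP => [e' _ ve'|nGe]; first rewrite ffunE.
  by congr (nat_of_bool _)%:R; rewrite -[LHS]val_eqE -[RHS]val_eqE /= ve'.
by case: eqP => // -[ee]; rewrite ee Gab in nGe.
Qed.

Definition extends (R : realType) (V : finType) (G H : graph V)
    (n : nat) (lab : V -> 'I_n)
    (J : 'End(graph_lie R G lab)) (Jt : 'End(graph_lie R H lab)) :=
  forall x : graph_lie R G lab, Jt (incl H x) = incl H (J x).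

Definition strictly_between (V : finType) (n : nat) (lab : V -> 'I_n)
    (v u w : V) : bool :=
  (lab v < lab u < lab w)%N || (lab w < lab u < lab v)%N.

(* The labels are pairwise distinct in each step, so u is either strictly
   between v and w, or smaller than both, or larger than both. *)
Definition is_tilde (R : realType) (V : finType) (B : graph V)
    (n : nat) (lab : V -> 'I_n) (J : 'End(graph_lie R B lab))
    (s : seq (V * V * V)) (Bt : graph V) (Jt : 'End(graph_lie R Bt lab)) :=
  [/\ forall i : V + edge B,
        Jt (incl Bt (basis_vec R i)) = incl Bt (J (basis_vec R i)),
      forall u v w : V, (u, v, w) \in s ->
        Jt (edge_vec R Bt v u) =
          if strictly_between lab v u w then - edge_vec R Bt w u
          else edge_vec R Bt w u
    & almost_complex Jt].

(* Main.v *)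
From HB Require Import structures.
Require Import Defs.
From mathcomp Require Import all_boot all_order all_algebra.
From mathcomp Require Import reals.
From mathcomp Require Import ring.

(** In bracket form the sign cases defining [Jt] disappear: a step (u, v, w)
    reads [Jt [u, v] = [u, w]].  Hence the new edges of that step contribute to
    the bracket of the expansion the 2-form (u* /\ theta) [u, v], with
    theta = v* + i w* and i acting as [Jt].  Since J v = w, theta is of type
    (1,0), so every such term satisfies the integrability identity whatever
    u* o J is; the old edges contribute the Nijenhuis tensor of J, which
    vanishes.  That new edges are never edges of B is where basic graphs enter:
    each of their vertices has degree at most 1. *)

Set Implicit Arguments.
Unset Strict Implicit.
Unset Printing Implicit Defensive.

Import Order.TTheory GRing.Theory Num.Theory.
Local Open Scope ring_scope.

(** * Graphs whose vertices have degree at most 1, and why basic graphs are of this kind *)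

Definition matching (V : finType) (G : graph V) :=
  forall (a : V) (e f : {set V}),
    e \in edges G -> f \in edges G -> a \in e -> a \in f -> e = f.

Lemma piece_matching p : matching (piece_graph p).
Proof.
case: p => a e f /=; first by rewrite inE.
  by move=> /set1P-> /set1P->.
by move=> /set2P[]-> /set2P[]-> //; rewrite !inE -!val_eqE /= !inordK //;
  case/orP=> /eqP->.
Qed.

(** Every vertex of an edge carries the tag of its summand, so two edges with a common vertex lie in
    the same summand. *)
Lemma disjoint_union_matching (I : finType) (T : I -> finType)
    (F : forall i, graph (T i)) :
  (forall i, matching (F i)) -> matching (disjoint_union F).
Proof.
move=> mF a e f /bigcupP[i _ /imsetP[d Fd ->]] /bigcupP[j _ /imsetP[d' Fd' ->]].
case/imsetP=> x xd -> /imsetP[y yd'] xy.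
have ij : i = j := congr1 tag xy.
subst j.
move/eqP: xy; rewrite eq_Tagged /= => /eqP xy.
by rewrite (mF _ _ _ _ Fd Fd' xd) // xy.
Qed.

Lemma graph_iso_matching (V W : finType) (G : graph V) (H : graph W) :
  graph_iso G H -> matching H -> matching G.
Proof.
case=> f /bij_inj fI fE mH a e e' Ge Ge' ae ae'.
by apply: (imset_inj fI); apply: (mH (f a)); rewrite ?fE ?imset_f.
Qed.

Lemma basic_matching (V : finType) (G : graph V) : basic G -> matching G.
Proof.
case=> m [p GH]; apply: graph_iso_matching GH _.
by apply: disjoint_union_matching => i; apply: piece_matching.
Qed.

(** * Coordinates on the span of V and E, and passage between two graphs on the same vertices *)

Section Space.
Variables (R : realType) (V : finType).
Implicit Types (G H : graph V) (e : {set V}).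

(** Indexed by an arbitrary set of vertices, with value 0 off the edges, so that one [e] can be read
    in several graphs without transporting membership proofs. [set_vec] follows the same
    convention. *)
Definition edge_coord G e (x : graph_space R G) : R :=
  if insub e is Some e' then x (inr e') else 0.

Definition set_vec G e : graph_space R G :=
  if insub e is Some e' then basis_vec R (inr e') else 0.

Lemma edge_vecE G a b : edge_vec R G a b = set_vec G [set a; b].
Proof. by []. Qed.

Lemma edge_coord_val G (x : graph_space R G) (e : edge G) :
  edge_coord (val e) x = x (inr e).
Proof. by rewrite /edge_coord valK. Qed.

Lemma edge_coordP G e a (x y : graph_space R G) :
  edge_coord e (a *: x + y) = a * edge_coord e x + edge_coord e y.
Proof.
by rewrite /edge_coord; case: insub => [e'|]; rewrite ?ffunE // mulr0 addr0.
Qed.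

Lemma edge_coord0 G e (x : graph_space R G) :
  e \notin edges G -> edge_coord e x = 0.
Proof. by move=> nGe; rewrite /edge_coord insubN. Qed.

Lemma basis_vec_vertex G a b :
  basis_vec R (inl a : V + edge G) (inl b) = (b == a)%:R.
Proof. by rewrite ffunE. Qed.

Lemma set_vec_vertex G e a : set_vec G e (inl a) = 0.
Proof. by rewrite /set_vec; case: insub => [e'|]; rewrite ffunE. Qed.

Lemma set_vec_edge G e (e' : edge G) : set_vec G e (inr e') = (val e' == e)%:R.
Proof.
rewrite /set_vec; case: insubP => [f _ <-|nGe]; rewrite ffunE //.
by case: eqP => // ee; rewrite -ee (valP e') in nGe.
Qed.

Lemma edge_coord_set_vec G e e' :
  edge_coord e (set_vec G e') = ((e == e') && (e \in edges G))%:R.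
Proof.
rewrite /edge_coord; case: insubP => [f Ge ve|/negPf->]; last by rewrite andbF.
by rewrite set_vec_edge ve Ge andbT.
Qed.

Lemma set_vec_basis G e :
  e \in edges G -> exists j, set_vec G e = basis_vec R j.
Proof. by move=> Ge; rewrite /set_vec insubT; eexists. Qed.

Lemma basis_vec_edge G (e : edge G) : basis_vec R (inr e) = set_vec G (val e).
Proof. by rewrite /set_vec valK. Qed.

Lemma incl_edgeE G H (x : graph_space R G) (e : edge H) :
  incl H x (inr e) = edge_coord (val e) x.
Proof. by rewrite ffunE. Qed.

Lemma incl_linear G H : linear (incl H : graph_space R G -> graph_space R H).
Proof.
move=> a x y; apply/ffunP => -[b|e]; first by rewrite !ffunE.
by rewrite incl_edgeE edge_coordP !ffunE.
Qed.
HB.instance Definition _ G H :=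
  GRing.isLinear.Build R (graph_space R G) (graph_space R H) _ (@incl R V G H)
    (@incl_linear G H).

Lemma incl_set_vec G H e :
  edges G \subset edges H -> e \in edges G ->
  incl H (set_vec G e) = set_vec H e.
Proof.
move=> /subsetP sGH Ge; apply/ffunP => -[b|f].
  by rewrite ffunE !set_vec_vertex.
rewrite incl_edgeE edge_coord_set_vec set_vec_edge.
by case: eqP => // ->; rewrite Ge.
Qed.

Lemma incl_set_vec0 G H e : e \notin edges H -> incl H (set_vec G e) = 0.
Proof.
move=> nHe; apply/ffunP => -[b|f]; first by rewrite !ffunE set_vec_vertex.
rewrite incl_edgeE edge_coord_set_vec [RHS]ffunE.
by case: eqP => // fe; rewrite -fe (valP f) in nHe.
Qed.

Lemma edge_coord_incl G H e (x : graph_space R G) :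
  e \notin edges G -> edge_coord e (incl H x) = 0.
Proof.
move=> nGe; rewrite {1}/edge_coord; case: insubP => // f _ fe.
by rewrite incl_edgeE fe edge_coord0.
Qed.

Lemma edge_coord_incl_in G H e (x : graph_space R G) :
  e \in edges H -> edge_coord e (incl H x) = edge_coord e x.
Proof. by move=> He; rewrite {1}/edge_coord insubT incl_edgeE. Qed.

(** With the two graphs exchanged, the formula of [incl] becomes the projection that forgets the
    edges outside [G]. Below, [incl G] on the larger space always plays this role. *)
Lemma inclK G H : edges G \subset edges H ->
  cancel (incl H : graph_space R G -> graph_space R H) (incl G).
Proof.
move=> /subsetP sGH x; apply/ffunP => -[b|f]; first by rewrite !ffunE.
by rewrite incl_edgeE edge_coord_incl_in ?edge_coord_val // sGH ?(valP f).
Qed.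

(** The larger space is the smaller one plus the lines of the new edges. Listing the edges without
    repetition makes each line count once. *)
Lemma incl_decomposition G H (es : seq {set V}) (x : graph_space R H) :
  uniq es -> edges H = edges G :|: [set e in es] ->
  (forall e, e \in es -> e \notin edges G) ->
  x = incl H (incl G x) + \sum_(e <- es) edge_coord e x *: set_vec H e.
Proof.
move=> ues HE dis; apply/ffunP => -[b|f].
  rewrite !ffunE sum_ffunE big1 ?addr0 // => e _.
  by rewrite ffunE set_vec_vertex scaler0.
rewrite ffunE incl_edgeE sum_ffunE -{1}edge_coord_val.
under eq_bigr => e _ do rewrite ffunE set_vec_edge.
have [Gf|nGf] := boolP (val f \in edges G).
  rewrite edge_coord_incl_in // big_seq big1 ?addr0 // => e /dis.
  by case: eqP => [<-|]; rewrite ?Gf ?scaler0.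
have fes : val f \in es.
  have : val f \in edges G :|: [set e in es] by rewrite -HE (valP f).
  by rewrite !inE (negPf nGf).
rewrite [X in _ = X + _]edge_coord0 // add0r (bigD1_seq (val f)) //= eqxx big1 => [|e].
  by rewrite addr0 /GRing.scale /= mulr1.
by rewrite eq_sym => /negPf->; rewrite scaler0.
Qed.

Lemma graph_space_decomposition G (x : graph_space R G) :
  x = \sum_i x i *: basis_vec R i.
Proof.
apply/ffunP => j; rewrite sum_ffunE (bigD1 j) //= big1 => [|i ij].
  by rewrite !ffunE eqxx addr0 /GRing.scale /= mulr1.
by rewrite !ffunE eq_sym (negPf ij) scaler0.
Qed.

End Space.

(** * The bracket of a graph Lie algebra in coordinates *)

Section Bracket.
Variables (R : realType) (V : finType) (G : graph V).
Variables (n : nat) (lab : V -> 'I_n).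
Implicit Types (a b : V) (x y : graph_space R G).

Local Notation bracket := (graph_bracket lab).

Definition vertex_bracket a b : graph_space R G :=
  basis_bracket R lab (inl a) (inl b).

(** The orientation sign: [a, b] is this scalar times the edge ab. *)
Definition lab_sign a b : R :=
  if (lab a < lab b)%N then 1 else if (lab b < lab a)%N then -1 else 0.

Lemma lab_signN a b : lab_sign b a = - lab_sign a b.
Proof. by rewrite /lab_sign; case: ltngtP; rewrite ?opprK ?oppr0. Qed.

Lemma lab_sign_sqr a b :
  injective lab -> a != b -> lab_sign a b * lab_sign a b = 1.
Proof.
move=> labI; rewrite -(inj_eq labI) -val_eqE /lab_sign /=.
by case: ltngtP; rewrite // ?mulr1 // mulrNN mulr1.
Qed.

(** The sign prescribed by cases for the new edges is a product of two orientation signs; this turns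
    the definition of the extension into an identity between brackets. *)
Lemma lab_sign_between a b c : injective lab -> a != b -> a != c ->
  lab_sign a b * lab_sign a c = if strictly_between lab b a c then -1 else 1.
Proof.
move=> labI; rewrite -!(inj_eq labI) -!val_eqE /lab_sign /strictly_between /=.
by do 2!case: ltngtP => _; rewrite //= => _ _; rewrite ?mulrNN ?mulr1 ?mul1r.
Qed.

Lemma vertex_bracketE a b :
  vertex_bracket a b = lab_sign a b *: set_vec R G [set a; b].
Proof.
rewrite /vertex_bracket /lab_sign /= edge_vecE.
by case: ltngtP; rewrite ?scale1r ?scaleN1r ?scale0r.
Qed.

Lemma set_vec_bracket a b : injective lab -> a != b ->
  set_vec R G [set a; b] = lab_sign a b *: vertex_bracket a b.
Proof.
by move=> labI ab; rewrite vertex_bracketE scalerA lab_sign_sqr ?scale1r.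
Qed.

Lemma vertex_bracket0 a b : [set a; b] \notin edges G -> vertex_bracket a b = 0.
Proof. by move=> nG; rewrite vertex_bracketE /set_vec insubN // scaler0. Qed.

Lemma graph_bracketZl c x y : bracket (c *: x) y = c *: bracket x y.
Proof.
rewrite scaler_sumr; apply: eq_bigr => i _; rewrite scaler_sumr.
by apply: eq_bigr => j _; rewrite !ffunE scalerA mulrA.
Qed.

Lemma graph_bracket_basis i j :
  bracket (basis_vec R i) (basis_vec R j) = basis_bracket (G := G) R lab i j.
Proof.
rewrite /graph_bracket (bigD1 i) //= (bigD1 j) //= !ffunE !eqxx mulr1 scale1r.
rewrite big1 ?addr0 => [|k /negPf jk]; last first.
  by rewrite !ffunE jk mulr0 scale0r.
rewrite big1 ?addr0 // => k /negPf ik; rewrite big1 // => l _.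
by rewrite !ffunE ik mul0r scale0r.
Qed.

(** Up to the orientation sign, the ab-coordinate of the bracket is the 2-form a* /\ b*. *)
Lemma edge_coord_bracket x y a b :
  a != b -> [set a; b] \in edges G ->
  edge_coord [set a; b] (bracket x y) =
    (x (inl a) * y (inl b) - x (inl b) * y (inl a)) * lab_sign a b.
Proof.
move=> ab Gab; rewrite /edge_coord insubT /graph_bracket pair_big /= sum_ffunE.
have bbE i j : basis_bracket R lab i j (inr (exist _ [set a; b] Gab)) =
    if (i, j) is (inl c, inl d)
    then lab_sign c d * ([set a; b] == [set c; d])%:R else 0.
  case: i j => [c|e] [d|f]; rewrite ?ffunE //.
  by rewrite -[LHS]/(vertex_bracket c d _) vertex_bracketE ffunE set_vec_edge.
under eq_bigr => p _ do rewrite ffunE bbE.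
(* Only the ordered pairs (a, b) and (b, a) yield the edge ab, with opposite signs; all other terms
   vanish. *)
rewrite (bigD1 (inl a, inl b)) //= (bigD1 (inl b, inl a)) /=; last first.
  by rewrite -pair_eqE /= negb_and; apply/orP; right; apply: contraNneq ab => -[->].
rewrite big1 => [|[[c|e] [d|f]]]; rewrite ?scaler0 //=.
  rewrite eqxx [[set b; a]]setUC eqxx (lab_signN a b) /GRing.scale /=.
  ring.
case/andP=> Nab Nba; case: eqP; rewrite ?mulr0 ?scaler0 // => /setP E.
move: (E a) (E b) (E c) (E d) ab Nab Nba.
rewrite -!pair_eqE /= !inE !eqxx ?orbT /=.
rewrite -[inl c == inl a]/(c == a) -[inl d == inl b]/(d == b).
rewrite -[inl c == inl b]/(c == b) -[inl d == inl a]/(d == a).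
by case/esym/orP=> /eqP->; case/esym/orP=> /eqP->; rewrite ?eqxx.
Qed.

Lemma edge_coord_bracketZ x y a b :
  a != b ->
  edge_coord [set a; b] (bracket x y) *: set_vec R G [set a; b] =
    (x (inl a) * y (inl b) - x (inl b) * y (inl a)) *: vertex_bracket a b.
Proof.
move=> ab; have [Gab|nGab] := boolP ([set a; b] \in edges G).
  by rewrite edge_coord_bracket // vertex_bracketE scalerA.
by rewrite vertex_bracket0 // /set_vec insubN // !scaler0.
Qed.

End Bracket.

(** The forgotten edges span a central ideal, so the projection is a morphism of Lie algebras. In
    coordinates, an edge of [G] reads the same 2-form in both algebras. *)
Lemma incl_graph_bracket (R : realType) (V : finType) (G H : graph V) (n : nat)
    (lab : V -> 'I_n) (x y : graph_space R H) :
  edges G \subset edges H ->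
  incl G (graph_bracket lab x y) =
    graph_bracket lab (incl G x) (incl G y).
Proof.
move=> /subsetP sGH; apply/ffunP => -[b|f].
  by rewrite ffunE !graph_bracket_vertex.
rewrite incl_edgeE -edge_coord_val.
have Gf : val f \in edges G := valP f.
have /cards2P[a [b [ab fE]]] : #|val f| == 2 by rewrite (edges_card2 Gf).
by rewrite fE in Gf; rewrite fE !edge_coord_bracket ?sGH // !ffunE.
Qed.

(** * Adapted complex structures on graphs of degree at most 1 *)

Section AdaptedOnMatching.
Variables (R : realType) (V : finType) (G : graph V).
Variables (n : nat) (lab : V -> 'I_n) (J : 'End(graph_lie R G lab)).

(** A real eigenvalue k would satisfy k^2 = -1. *)
Lemma almost_complex_basis_neq (i : V + edge G) (k : R) :
  almost_complex J -> J (basis_vec R i) <> k *: basis_vec R i.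
Proof.
move=> Jac Ji; have := Jac (basis_vec R i).
rewrite Ji linearZ /= Ji scalerA => /ffunP/(_ i); rewrite !ffunE eqxx.
rewrite /GRing.scale /= mulr1 => kk.
have := sqr_ge0 k; rewrite expr2 kk => h.
by have := ler0N1 R; rewrite h.
Qed.

(* If uv were an edge, the uv-coordinate of the integrability identity at (u, v)
   would reduce to that of [u, v] alone. *)
Lemma adapted_matching_nonedge (k : R) (u v w : V) :
  matching G -> injective lab -> adapted_complex_structure J ->
  J (basis_vec R (inl v)) = k *: basis_vec R (inl w) ->
  u != v -> u != w -> [set u; v] \notin edges G.
Proof.
move=> mG labI [[Jac Jint] Jad] Jv uv uw; apply/negP => Guv.
have vw : v != w.
  apply/eqP => vw; apply: (@almost_complex_basis_neq (inl v) k Jac).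
  by rewrite Jv vw.
have nGuw : [set u; w] \notin edges G.
  apply/negP => Guw; have := mG u _ _ Guv Guw; rewrite !inE eqxx => /(_ isT isT).
  by move/setP/(_ v); rewrite !inE eqxx orbT eq_sym (negPf uv) (negPf vw).
(* Ju is a multiple of a basis vector. If that is an edge, it is central. If it is a vertex a
   adjacent to v, then av and uv meet at v, so a = u and u would be an eigenvector of J. *)
have Juv : graph_bracket lab (J (basis_vec R (inl u))) (basis_vec R (inl v)) = 0.
  have [j [c Ju]] : exists j c, J (basis_vec R (inl u)) = c *: basis_vec R j.
    have [j [Ju|Ju]] := Jad (inl u); exists j.
      by exists 1; rewrite scale1r.
    by exists (-1); rewrite scaleN1r -Ju opprK.
  rewrite Ju graph_bracketZl graph_bracket_basis.
  case: j => [a|e] in Ju *; last by rewrite scaler0.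
  rewrite -[basis_bracket _ _ _ _]/(vertex_bracket R G lab a v).
  rewrite vertex_bracket0 ?scaler0 //; apply/negP => Gav.
  have av : a != v.
    by apply: contra_eqN (edges_card2 Gav) => /eqP->; rewrite cards2 eqxx.
  have := mG v _ _ Gav Guv; rewrite !inE eqxx !orbT => /(_ isT isT).
  move/setP/(_ a); rewrite !inE eqxx (negPf av) !orbF => /esym/eqP au.
  by apply: (@almost_complex_basis_neq (inl u) c Jac); rewrite Ju au.
have uJv : graph_bracket lab (basis_vec R (inl u)) (J (basis_vec R (inl v))) = 0.
  rewrite Jv graph_bracketC graph_bracketZl graph_bracket_basis.
  rewrite -[basis_bracket _ _ _ _]/(vertex_bracket R G lab w u).
  by rewrite vertex_bracket0 ?scaler0 ?oppr0 // setUC.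
have := Jint (basis_vec R (inl u)) (basis_vec R (inl v)).
rewrite /= Juv uJv addr0 linear0 addr0 => /subr0_eq.
move/(congr1 (edge_coord [set u; v])); rewrite !edge_coord_bracket // Jv.
(* Jv is a multiple of w and has no u- or v-coordinate, so [Ju, Jv] has no uv-coordinate; what
   remains says that an orientation sign is 0. *)
rewrite !(basis_vec_vertex, ffunE) !eqxx (negPf uv) (negPf uw) (negPf vw).
rewrite !scaler0 !mulr0 subrr mul0r mulr1 subr0 mul1r => sgn0.
have /eqP := lab_sign_sqr R labI uv.
by rewrite sgn0 mul0r eq_sym oner_eq0.
Qed.

(** J permutes the basis up to sign, so no basis vector other than i is sent to the line of j. *)
Lemma adapted_coord (i j : V + edge G) (k : R) (z : graph_space R G) :
  adapted_complex_structure J ->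
  J (basis_vec R i) = k *: basis_vec R j -> (J z : graph_space R G) j = k * z i.
Proof.
move=> [[Jac _] Jad] Ji; rewrite {1}[z]graph_space_decomposition linear_sum /=.
rewrite sum_ffunE (bigD1 i) //= linearZ /= Ji big1 => [|l li].
  by rewrite !ffunE eqxx addr0 /GRing.scale /= mulr1 mulrC.
rewrite linearZ /= ffunE; suff -> : (J (basis_vec R l) : graph_space R G) j = 0.
  by rewrite scaler0.
have [m [c [c0 Jl]]] : exists m c, c != 0 /\ J (basis_vec R l) = c *: basis_vec R m.
  have [m [Jl|Jl]] := Jad l; exists m.
    by exists 1; rewrite oner_eq0 scale1r.
  by exists (-1); rewrite oppr_eq0 oner_eq0 scaleN1r -Jl opprK.
rewrite Jl !ffunE; have [jm|] := eqVneq j m; last by rewrite scaler0.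
(* If l were also sent to the line of j, applying J once more would make l and i proportional;
   compare the coordinates at i. *)
have : J (k *: J (basis_vec R l)) = J (c *: J (basis_vec R i)).
  by rewrite Jl Ji jm !scalerA mulrC.
rewrite !linearZ /= !Jac => /ffunP/(_ i); rewrite !ffunE eqxx eq_sym (negPf li).
by move/eqP; rewrite oppr0 scaler0 eq_sym scaler_eq0 (negPf c0) oppr_eq0 oner_eq0.
Qed.

End AdaptedOnMatching.

(** * The edges added by an expansion, as a list without repetition *)

Section Expansion.
Variables (R : realType) (V : finType).

Definition step_edges (t : V * V * V) : seq {set V} :=
  [:: [set t.1.1; t.1.2]; [set t.1.1; t.2]].

(** A list rather than a set, so that sums over new edges regroup into sums over steps. *)
Definition new_edges (s : seq (V * V * V)) := flatten (map step_edges s).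

Lemma added_edgesE s : added_edges s = [set e in new_edges s].
Proof.
apply/setP => e; rewrite !inE; apply/hasP/flatten_mapP => -[[[u v] w] ts].
  by move=> eE; exists (u, v, w); rewrite // !inE.
by rewrite !inE => eE; exists (u, v, w).
Qed.

Lemma big_new_edges (M : zmodType) s (F : {set V} -> M) :
  \sum_(e <- new_edges s) F e =
    \sum_(t <- s) (F [set t.1.1; t.1.2] + F [set t.1.1; t.2]).
Proof.
rewrite big_flatten big_map; apply: eq_bigr => t _.
by rewrite !big_cons big_nil /= addr0.
Qed.

Section Steps.
Variables (G : graph V) (n : nat) (lab : V -> 'I_n).
Variable (J : 'End(graph_lie R G lab)).

Lemma expansion_stepsP s u v w :
  expansion_steps J s -> (u, v, w) \in s ->
  [/\ basis_vec R (inl w) = J (basis_vec R (inl v)), u != v & u != w].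
Proof.
elim=> // {}s u' v' w' _ IH Jw uv uw _ _.
by rewrite mem_rcons inE => /predU1P[[-> -> ->]|/IH].
Qed.

(** Repetition across steps is excluded by definition. Within one step, uv = uw would give v = w =
    Jv, against J^2 = -1. *)
Lemma expansion_steps_uniq s :
  almost_complex J -> expansion_steps J s -> uniq (new_edges s).
Proof.
move=> Jac; elim=> // {}s u v w _ IH Jw uv uw.
rewrite added_edgesE !inE => nuv nuw.
rewrite /new_edges map_rcons flatten_rcons cat_uniq IH /= orbF negb_or nuv nuw /=.
rewrite inE andbT; apply/eqP => /setP/(_ v).
rewrite !inE eqxx orbT eq_sym (negPf uv) /= => /esym/eqP vw.
by apply: (almost_complex_basis_neq (i := inl v) (k := 1) Jac); rewrite scale1r -Jw vw.
Qed.

End Steps.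
End Expansion.

(** * Extending J linearly by prescribed images of new edges *)

Section Extension.
Variables (R : realType) (V : finType) (G H : graph V).
Variables (n : nat) (lab : V -> 'I_n) (J : 'End(graph_lie R G lab)).
Variables (L : seq ({set V} * graph_space R H)).

(** [L] pairs each new edge with its intended image; the old part of x is handled by J through
    projection and inclusion. *)
Definition extension_fun (x : graph_space R H) : graph_space R H :=
  incl H (J (incl G x)) + \sum_(p <- L) edge_coord p.1 x *: p.2.

Lemma extension_fun_linear : linear extension_fun.
Proof.
move=> a x y; rewrite /extension_fun !linearP /= scalerDr scaler_sumr.
rewrite addrACA -big_split; congr (_ + _); apply: eq_bigr => p _ /=.
by rewrite edge_coordP scalerDl scalerA.
Qed.
HB.instance Definition _ := GRing.isLinear.Build R (graph_space R H)
  (graph_space R H) _ extension_fun extension_fun_linear.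

Hypothesis sGH : edges G \subset edges H.
Hypothesis Lnew : forall e, e \in map fst L -> e \notin edges G.

Lemma extension_fun_incl x : extension_fun (incl H x) = incl H (J x).
Proof.
rewrite /extension_fun inclK // big_seq big1 ?addr0 // => p pL.
by rewrite edge_coord_incl ?scale0r // Lnew ?map_f.
Qed.

Lemma extension_fun_set_vec e y :
  uniq (map fst L) -> (e, y) \in L -> e \in edges H ->
  extension_fun (set_vec R H e) = y.
Proof.
move=> uL eyL He; rewrite /extension_fun incl_set_vec0; last first.
  by apply: Lnew; apply/mapP; exists (e, y).
rewrite !linear0 add0r; elim: L uL eyL => // -[f z] l IH /= /andP[fl ul].
rewrite big_cons /= edge_coord_set_vec inE => /predU1P[[ef yz]|eyl].
  rewrite -ef -yz eqxx He scale1r big_seq big1 ?addr0 // => p pl.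
  rewrite edge_coord_set_vec; case: eqP => [pe|]; rewrite ?scale0r //.
  by rewrite -ef -pe map_f in fl.
rewrite IH //; case: eqP => [fe|]; rewrite ?scale0r ?add0r //.
by rewrite fe (map_f fst eyl) in fl.
Qed.

End Extension.

(** * The extended structure: bracket form, uniqueness, integrability, adaptedness, existence *)

Section Main.
Variables (R : realType) (V : finType) (B : graph V).
Variables (n : nat) (lab : V -> 'I_n) (J : 'End(graph_lie R B lab)).
Variables (s : seq (V * V * V)) (Bt : graph V).
Hypotheses (mB : matching B) (labI : injective lab).
Hypotheses (Jad : adapted_complex_structure J) (sBt : expansion J s Bt).

Local Notation F := (vertex_bracket R Bt lab).

Let Jac : almost_complex J := Jad.1.1.

Lemma expansion_edgesE : edges Bt = edges B :|: [set e in new_edges s].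
Proof. by rewrite sBt.2 added_edgesE. Qed.

Lemma expansion_edges_sub : edges B \subset edges Bt.
Proof. by rewrite expansion_edgesE subsetUl. Qed.

(** The scalars 1 and -1 are kept explicit so that facts about J a = k b apply to v and to w
    alike. *)
Lemma step_pair t : t \in s ->
  [/\ J (basis_vec R (inl t.1.2)) = 1 *: basis_vec R (inl t.2),
      J (basis_vec R (inl t.2)) = -1 *: basis_vec R (inl t.1.2),
      t.1.1 != t.1.2 & t.1.1 != t.2].
Proof.
case: t => [[u v] w] /(expansion_stepsP sBt.1)[-> uv uw].
by rewrite scale1r scaleN1r Jac.
Qed.

Lemma new_edges_notin e : e \in new_edges s -> e \notin edges B.
Proof.
case/flatten_mapP=> t /step_pair[Jv Jw uv uw]; rewrite !inE => /orP[]/eqP->.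
  exact: adapted_matching_nonedge Jv uv uw.
exact: adapted_matching_nonedge Jw uw uv.
Qed.

Lemma new_edges_in t : t \in s ->
  [set t.1.1; t.1.2] \in edges Bt /\ [set t.1.1; t.2] \in edges Bt.
Proof.
move=> ts; rewrite expansion_edgesE; split; rewrite !inE; apply/orP; right;
  by apply/flatten_mapP; exists t; rewrite // !inE eqxx ?orbT.
Qed.

Lemma incl_step t : t \in s ->
  incl B (F t.1.1 t.1.2) = 0 /\ incl B (F t.1.1 t.2) = 0.
Proof.
move=> ts; rewrite !vertex_bracketE; split; rewrite linearZ /= incl_set_vec0 ?scaler0 //;
  by apply: new_edges_notin; apply/flatten_mapP; exists t; rewrite // !inE eqxx ?orbT.
Qed.

Lemma expansion_decomposition (x : graph_space R Bt) :
  x = incl Bt (incl B x) + \sum_(t <- s)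
    (edge_coord [set t.1.1; t.1.2] x *: set_vec R Bt [set t.1.1; t.1.2] +
     edge_coord [set t.1.1; t.2] x *: set_vec R Bt [set t.1.1; t.2]).
Proof.
have := incl_decomposition x (expansion_steps_uniq Jac sBt.1) expansion_edgesE.
by move=> /(_ new_edges_notin); rewrite big_new_edges.
Qed.

(** The sign-free form of [is_tilde]: each step acts as a quarter turn on the plane of [u, v] and
    [u, w]. The two forms are shown equivalent below. *)
Definition tilde_like (Jt : 'End(graph_lie R Bt lab)) :=
  (forall z, Jt (incl Bt z) = incl Bt (J z)) /\
  (forall t, t \in s ->
     Jt (F t.1.1 t.1.2) = F t.1.1 t.2 /\ Jt (F t.1.1 t.2) = - F t.1.1 t.1.2).

Lemma is_tilde_like Jt : is_tilde J s Jt -> tilde_like Jt.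
Proof.
move=> [JtB Jts Jtac]; split=> [z|[[u v] w] ts].
  rewrite [z]graph_space_decomposition !linear_sum /=.
  by apply: eq_bigr => i _; rewrite !linearZ /= JtB.
have [_ _ /= uv uw] := step_pair ts.
have JtF : Jt (F u v) = F u w.
  rewrite vertex_bracketE linearZ /= [[set u; v]]setUC -edge_vecE (Jts _ _ _ ts).
  rewrite !edge_vecE vertex_bracketE [[set w; u]]setUC.
  (* Inserting the square of the sign of (u, v) produces the product of signs that equals the
     prescribed one. *)
  rewrite -[lab_sign R lab u w]mul1r -(lab_sign_sqr R labI uv) -mulrA.
  rewrite lab_sign_between //; case: ifP => _; last by rewrite mulr1.
  by rewrite mulrN1 scalerN scaleNr.
by rewrite -JtF Jtac.
Qed.

(** The right-hand side does not involve [Jt], whence uniqueness. *)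
Lemma tilde_formula Jt (x : graph_space R Bt) : tilde_like Jt ->
  Jt x = incl Bt (J (incl B x)) + \sum_(t <- s)
    ((edge_coord [set t.1.1; t.1.2] x * lab_sign R lab t.1.1 t.1.2) *:
       F t.1.1 t.2 -
     (edge_coord [set t.1.1; t.2] x * lab_sign R lab t.1.1 t.2) *:
       F t.1.1 t.1.2).
Proof.
move=> [JtB Jts]; rewrite {1}[x]expansion_decomposition linearD /= JtB linear_sum.
congr (_ + _); rewrite !big_seq; apply: eq_bigr => t ts.
have [_ _ uv uw] := step_pair ts; have [Jv Jw] := Jts t ts.
by rewrite !(set_vec_bracket R Bt labI) // !scalerA linearD !linearZ /= Jv Jw scalerN.
Qed.

Lemma tilde_like_is_tilde Jt : tilde_like Jt -> is_tilde J s Jt.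
Proof.
move=> Jtl; have [JtB Jts] := Jtl; split=> [i|u v w ts|x]; first exact: JtB.
  have [_ _ /= uv uw] := step_pair ts; have [/= Jv _] := Jts _ ts.
  rewrite !edge_vecE setUC [[set w; u]]setUC (set_vec_bracket R Bt labI) // linearZ /= Jv.
  rewrite vertex_bracketE scalerA lab_sign_between //.
  by case: ifP; rewrite ?scaleN1r ?scale1r.
rewrite (tilde_formula x Jtl) linearD /= JtB Jac linear_sum.
rewrite [X in _ = - X]expansion_decomposition opprD linearN -sumrN; congr (_ + _).
rewrite !big_seq; apply: eq_bigr => t ts.
have [_ _ uv uw] := step_pair ts; have [Jv Jw] := Jts t ts.
rewrite !(set_vec_bracket R Bt labI) // !scalerA linearB !linearZ /= Jv Jw.
by rewrite !scalerN opprD.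
Qed.

(** The span of the new edges is stable under [Jt] and killed by the projection. *)
Lemma incl_tilde Jt (x : graph_space R Bt) : tilde_like Jt ->
  incl B (Jt x) = J (incl B x).
Proof.
move=> /tilde_formula->; rewrite linearD /= inclK ?expansion_edges_sub //.
rewrite linear_sum big_seq big1 ?addr0 // => t /incl_step[Fv Fw].
by rewrite linearB !linearZ /= Fv Fw oppr0 !scaler0 addr0.
Qed.

Lemma bracket_decomposition (x y : graph_space R Bt) :
  graph_bracket lab x y = incl Bt (graph_bracket lab (incl B x) (incl B y)) +
    \sum_(t <- s)
     ((x (inl t.1.1) * y (inl t.1.2) - x (inl t.1.2) * y (inl t.1.1)) *:
        F t.1.1 t.1.2 +
      (x (inl t.1.1) * y (inl t.2) - x (inl t.2) * y (inl t.1.1)) *: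
        F t.1.1 t.2).
Proof.
rewrite {1}[graph_bracket lab x y]expansion_decomposition.
rewrite incl_graph_bracket ?expansion_edges_sub //; congr (_ + _).
rewrite !big_seq; apply: eq_bigr => t /step_pair[_ _ uv uw].
by rewrite !edge_coord_bracketZ.
Qed.

Lemma tilde_bracket Jt (x y : graph_space R Bt) : tilde_like Jt ->
  Jt (graph_bracket lab x y) =
    incl Bt (J (graph_bracket lab (incl B x) (incl B y))) +
    \sum_(t <- s)
     ((x (inl t.1.1) * y (inl t.1.2) - x (inl t.1.2) * y (inl t.1.1)) *:
        F t.1.1 t.2 -
      (x (inl t.1.1) * y (inl t.2) - x (inl t.2) * y (inl t.1.1)) *:
        F t.1.1 t.1.2).
Proof.
move=> [JtB Jts]; rewrite bracket_decomposition linearD /= JtB [X in _ + X = _]linear_sum.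
congr (_ + _); rewrite !big_seq; apply: eq_bigr => t /Jts[Jv Jw].
by rewrite linearD !linearZ /= Jv Jw scalerN.
Qed.

(** Dual form of Jv = w: for theta = v* + i w*, this says that theta o J = i theta, that is, theta
    has type (1,0). *)
Lemma tilde_coord Jt (x : graph_space R Bt) t : tilde_like Jt -> t \in s ->
  (Jt x : graph_space R Bt) (inl t.1.2) = - x (inl t.2) /\
  (Jt x : graph_space R Bt) (inl t.2) = x (inl t.1.2).
Proof.
move=> Jtl /step_pair[Jv Jw _ _].
have vE a : (Jt x : graph_space R Bt) (inl a) = (J (incl B x) : graph_space R B) (inl a).
  by rewrite -(incl_tilde _ Jtl) ffunE.
rewrite !vE (adapted_coord _ Jad Jw) (adapted_coord _ Jad Jv) !ffunE.
by rewrite mulN1r mul1r.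
Qed.

Lemma tilde_integrable Jt : tilde_like Jt -> integrable Jt.
Proof.
move=> Jtl x y /=; rewrite [Jt (_ + _)]linearD /=.
rewrite !(tilde_bracket _ _ Jtl) !bracket_decomposition !(incl_tilde _ Jtl).
set x' := incl B x; set y' := incl B y.
(* The old edges contribute the inclusion of the integrability identity of J at the projected
   vectors. *)
have JB : incl Bt (graph_bracket lab x' y') +
    (incl Bt (J (graph_bracket lab (J x') y')) +
     incl Bt (J (graph_bracket lab x' (J y')))) -
    incl Bt (graph_bracket lab (J x') (J y')) = 0.
  have := congr1 (incl Bt) (Jad.1.2 x' y').
  by rewrite /= [J (_ + _)]linearD /= linearB !linearD linear0.
rewrite [X in _ + X - _]addrACA [X in X - _]addrACA opprD [LHS]addrACA JB add0r.
rewrite -sumrN -!big_split big_seq big1 // => t ts.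
have [xv xw] := tilde_coord x Jtl ts; have [yv yw] := tilde_coord y Jtl ts.
(* The u-coordinates of [Jt x] and [Jt y] stay as free unknowns; the identity is polynomial in
   them. *)
apply/ffunP => i; rewrite !ffunE xv xw yv yw /GRing.scale /=.
ring.
Qed.

Lemma tilde_adapted Jt (i : V + edge Bt) : tilde_like Jt ->
  exists j : V + edge Bt,
    Jt (basis_vec R i) = basis_vec R j \/ - Jt (basis_vec R i) = basis_vec R j.
Proof.
move=> Jtl; have [JtB Jts] := Jtl.
have inclP (k : V + edge B) :
    exists j : V + edge Bt, incl Bt (basis_vec R k) = basis_vec R j.
  case: k => [a|e]; first by exists (inl a); rewrite incl_vertex.
  have [j jE] := set_vec_basis R (subsetP expansion_edges_sub _ (valP e)).
  by exists j; rewrite basis_vec_edge incl_set_vec ?expansion_edges_sub ?(valP e).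
(* Vertices and old edges inherit the property from J, through the inclusion. *)
have oldP (k : V + edge B) (j : V + edge Bt) :
    incl Bt (basis_vec R k) = basis_vec R j -> exists l : V + edge Bt,
    Jt (basis_vec R j) = basis_vec R l \/ - Jt (basis_vec R j) = basis_vec R l.
  move=> <-; have [l Jl] := Jad.2 k; have [m lm] := inclP l; exists m.
  by case: Jl => Jl; [left|right]; rewrite JtB -lm -Jl ?linearN.
case: i => [a|e]; first by apply: (oldP (inl a)); rewrite incl_vertex.
have [Be|nBe] := boolP (val e \in edges B).
  apply: (oldP (inr (exist _ (val e) Be))).
  by rewrite !basis_vec_edge incl_set_vec ?expansion_edges_sub.
have : val e \in edges B :|: [set e in new_edges s].
  by rewrite -expansion_edgesE (valP e).
rewrite !inE (negPf nBe) /= => /flatten_mapP[t ts].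
have [_ _ uv uw] := step_pair ts; have [Jv Jw] := Jts t ts.
have [Buv Buw] := new_edges_in ts.
have [j jE] := set_vec_basis R Buv; have [k kE] := set_vec_basis R Buw.
(* A new edge goes to its partner up to a product of two orientation signs, which is 1 or -1. *)
have signP a b c : a != b -> a != c ->
    lab_sign R lab a b * lab_sign R lab a c = 1 \/
    lab_sign R lab a b * lab_sign R lab a c = -1.
  by move=> ab ac; rewrite lab_sign_between //; case: ifP; [right|left].
rewrite !inE => /orP[]/eqP eE; rewrite basis_vec_edge (eE : val e = _).
  exists k; rewrite (set_vec_bracket R Bt labI) // linearZ /= Jv vertex_bracketE.
  rewrite scalerA -kE; case: (signP _ _ _ uv uw) => ->.
    by left; rewrite scale1r.
  by right; rewrite scaleN1r opprK.
exists j; rewrite (set_vec_bracket R Bt labI) // linearZ /= Jw vertex_bracketE.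
rewrite scalerN scalerA -jE; case: (signP _ _ _ uw uv) => ->.
  by right; rewrite scale1r opprK.
by left; rewrite scaleN1r opprK.
Qed.

Lemma tilde_exists : exists Jt, tilde_like Jt.
Proof.
(* The images are forced: the edge uv is its orientation sign times [u, v], which must go to [u, w];
   likewise uw, with [u, w] going to -[u, v]. *)
pose images (t : V * V * V) : seq ({set V} * graph_space R Bt) :=
  [:: ([set t.1.1; t.1.2], lab_sign R lab t.1.1 t.1.2 *: F t.1.1 t.2);
      ([set t.1.1; t.2], lab_sign R lab t.1.1 t.2 *: - F t.1.1 t.1.2)].
pose L := flatten (map images s).
have LE : map fst L = new_edges s by rewrite map_flatten -map_comp.
have Lnew e : e \in map fst L -> e \notin edges B.
  by rewrite LE; apply: new_edges_notin.
have uL : uniq (map fst L) by rewrite LE (expansion_steps_uniq Jac sBt.1).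
exists (linfun (extension_fun J L)); split=> [z|t ts].
  by rewrite lfunE /= extension_fun_incl ?expansion_edges_sub.
have [_ _ uv uw] := step_pair ts; have [Buv Buw] := new_edges_in ts.
have extL e y : (e, y) \in images t -> e \in edges Bt ->
    extension_fun J L (set_vec R Bt e) = y.
  move=> eyt; apply: extension_fun_set_vec => //.
  by apply/flatten_mapP; exists t.
have extv := extL _ _ (mem_head _ _) Buv.
have extw := extL _ _ (mem_last (_, _) [:: _]) Buw.
rewrite !lfunE /=; split; rewrite vertex_bracketE linearZ /= ?extv ?extw.
  by rewrite scalerA lab_sign_sqr ?scale1r.
by rewrite scalerA lab_sign_sqr ?scale1r.
Qed.

End Main.

Theorem theorem5p12 (R : realType) (V : finType) (B : graph V)
    (n : nat) (lab : V -> 'I_n) (J : 'End(graph_lie R B lab))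
    (s : seq (V * V * V)) (Bt : graph V) :
  basic B ->
  bijective lab ->
  adapted_complex_structure J ->
  expansion J s Bt ->
  (exists! Jt : 'End(graph_lie R Bt lab), is_tilde J s Jt) /\
  (forall Jt : 'End(graph_lie R Bt lab), is_tilde J s Jt ->
    [/\ integrable Jt, adapted_complex_structure Jt & extends J Jt]).
Proof.
move=> /basic_matching mB /bij_inj labI Jad sBt; split.
  have [Jt Jtl] := tilde_exists mB labI Jad sBt.
  exists Jt; split; first exact: tilde_like_is_tilde Jtl.
  move=> Jt' /(is_tilde_like labI Jad sBt) Jtl'; apply/lfunP => x.
  by rewrite !(tilde_formula mB labI Jad sBt).
move=> Jt JtT; have Jtl := is_tilde_like labI Jad sBt JtT.
have Jint : integrable Jt by apply: tilde_integrable Jtl.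
split=> //; last exact: Jtl.1.
split; first by split=> //; case: JtT.
by move=> i; apply: tilde_adapted Jtl.
Qed.
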